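(* Let $m\ge 1$ be a real number. For each positive integer $n$, let $A_n$ be the symmetric $n\times n$ real matrix whose $(i,j)$ entry is $e^{\min(i,j)/\max(i,j)}$ for $1\le i,j\le n$. Then \[ \lim_{n\rightarrow\infty}\frac{1}{n^2}\|A_n\|_{m}^{m}=\frac{1}{m}(e^m-1). \]
   Context: For a real $n\times n$ matrix $A=(a_{ij})$, $\|A\|_m$ denotes the entrywise $m$-norm, i.e. $\|A\|_m^m=\sum_{i=1}^n\sum_{j=1}^n|a_{ij}|^m$ (not an operator norm). *)

(* Defs.v *)
From mathcomp Require Import all_boot all_order all_algebra.
From mathcomp Require Import all_classical all_reals all_analysis.

Set Implicit Arguments.
Unset Strict Implicit.
Unset Printing Implicit Defensive.

Import Order.TTheory GRing.Theory Num.Theory.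
Import numFieldNormedType.Exports.
Local Open Scope classical_set_scope.
Local Open Scope ring_scope.

(* Entrywise norm (sum_ij |a_ij|^m)^(1/m), as opposed to the sup norm that the
   library puts on matrices; it is meant for m >= 1. *)
Definition entry_norm (R : realType) (m : R) (n : nat) (A : 'M[R]_n) : R :=
  (\sum_(i < n) \sum_(j < n) `|A i j| `^ m) `^ m^-1.

(* The indices of 'I_n start at 0, hence the shifts by one. *)
Definition exp_minmax_mx (R : realType) (n : nat) : 'M[R]_n :=
  \matrix_(i < n, j < n)
    expR ((minn i.+1 j.+1)%:R / (maxn i.+1 j.+1)%:R).

Lemma exp_minmax_mx_sym (R : realType) (n : nat) :
  (exp_minmax_mx R n)^T = exp_minmax_mx R n.
Proof. by apply/matrixP => i j; rewrite !mxE minnC maxnC. Qed.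

Lemma entry_normX (R : realType) (m : R) (n : nat) (A : 'M[R]_n) :
  1 <= m ->
  entry_norm m A `^ m = \sum_(i < n) \sum_(j < n) `|A i j| `^ m.
Proof.
move=> m1; rewrite /entry_norm -powRrM mulVf ?powRr1 //.
  by apply: sumr_ge0 => i _; apply: sumr_ge0 => j _; exact: powR_ge0.
by rewrite gt_eqF // (lt_le_trans ltr01 m1).
Qed.

(* Main.v *)
Require Import Defs.
From mathcomp Require Import all_boot all_order all_algebra.
From mathcomp Require Import all_classical all_reals all_analysis.
From mathcomp Require Import ring lra.

Import Order.TTheory GRing.Theory Num.Theory.
Import numFieldNormedType.Exports.
Local Open Scope classical_set_scope.
Local Open Scope ring_scope.

(** Write [L = (e^m - 1) / m], the integral of [e^(m x)] over [[0, 1]], and let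
    [S_n] be the sum of [e^(m min(i,j)/max(i,j))] over [1 <= i, j <= n].
    Passing from [n - 1] to [n] adds one row and one column, both containing
    the values [e^(m k/n)] for [1 <= k <= n] and sharing the corner [e^m]; so
    the increment is [2 T_n - e^m], where [T_n] is the sum of [e^(m k/n)] over
    [1 <= k <= n].

    This [T_n] is a geometric sum of ratio [q = e^(m/n)], and
    [T_n = q (e^m - 1) / (q - 1)].  The inequality [1 + x <= e^x], used at
    [m/n] and at [- m/n], gives [n L <= T_n <= n L + (e^m - 1)]
    (lemma [geometric_expR_sum_bounds]).  The increment of [S_n] therefore
    differs from [(2 n - 1) L], the increment of [n^2 L], by at most
    [L + e^m].  Summing, [S_n] differs from [n^2 L] by at most [n (L + e^m)]
    (lemma [minmax_sum_bound]), an error which is negligible after division by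
    [n^2]. *)

(** The last row and the last column have equal sums by symmetry, and they share
    the corner [a n n]. *)
Lemma sum_square_symS (V : zmodType) (a : nat -> nat -> V) (n : nat) :
  (forall i j, a i j = a j i) ->
  \sum_(i < n.+1) \sum_(j < n.+1) a i j =
  \sum_(i < n) \sum_(j < n) a i j + ((\sum_(k < n.+1) a k n) *+ 2 - a n n).
Proof.
move=> a_sym; rewrite big_ord_recr /=.
under eq_bigr => i _ do rewrite big_ord_recr /=.
rewrite big_split /= -addrA; congr (_ + _).
have -> : \sum_(j < n.+1) a n j = \sum_(k < n.+1) a k n by exact: eq_bigr.
by rewrite mulr2n addrAC; congr (_ + _); rewrite big_ord_recr addrK.
Qed.

(** These are the bounds for the right Riemann sum of the increasing function
    [x |-> e^(m x)] on [[0, 1]] with [n + 1] steps; as the sum is geometric they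
    follow from [1 + x <= e^x] alone, without integration. *)
Lemma geometric_expR_sum_bounds (R : realType) (m : R) (n : nat) : 0 < m ->
  n.+1%:R * ((expR m - 1) / m)
    <= \sum_(k < n.+1) expR (m * (k.+1%:R / n.+1%:R))
    <= n.+1%:R * ((expR m - 1) / m) + (expR m - 1).
Proof.
move=> m0; set L := (expR m - 1) / m; set T := \sum_(_ < _) _.
have N0 : 0 < n.+1%:R :> R by rewrite ltr0n.
set x := m / n.+1%:R; have x0 : 0 < x by rewrite divr_gt0.
have q1 : 1 + x <= expR x by exact: expR_ge1Dx.
(* the same inequality at [- x], multiplied by [expR x] *)
have q2 : expR x * (1 - x) <= 1.
  by rewrite mulrC -ler_pdivlMr ?expR_gt0 // mul1r -expRN expR_ge1Dx.
have ET : (expR x - 1) * T = expR x * (expR m - 1).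
  have -> : T = expR x * \sum_(k < n.+1) expR x ^+ k.
    rewrite mulr_sumr; apply: eq_bigr => k _.
    rewrite -exprS -expRM_natl; congr expR.
    by rewrite /x; ring.
  rewrite mulrCA -subrX1 -expRM_natl; congr (_ * (expR _ - 1)).
  by rewrite /x; field; rewrite addrC natr1 gt_eqF.
have Em : 0 < expR m - 1 by rewrite subr_gt0 expR_gt1.
have -> : n.+1%:R * L = (expR m - 1) / x.
  by rewrite /L /x; field; rewrite addrC natr1 !gt_eqF.
have y0 : 0 < expR x - 1 by lra.
have -> : T = (expR m - 1) * (expR x / (expR x - 1)).
  by apply: (mulfI (lt0r_neq0 y0)); rewrite ET; field; rewrite gt_eqF.
rewrite -[X in _ <= _ <= _ + X]mulr1 -mulrDr !ler_pM2l //.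
apply/andP; split.
  by rewrite ler_pdivlMr // mulrC ler_pdivrMr //; lra.
rewrite ler_pdivrMr //.
have -> : expR x = 1 + (expR x - 1) by ring.
rewrite [X in _ <= _ * X]addrAC subrr add0r mulrDl mul1r.
by rewrite lerD2r mulrC ler_pdivlMr // mul1r; lra.
Qed.

(** Both [S_n] and [n^2 L] are compared increment by increment, the increment
    of [n^2 L] being [(2 n + 1) L]. *)
Lemma minmax_sum_bound (R : realType) (m : R) (n : nat) : 0 < m ->
  `|\sum_(i < n) \sum_(j < n)
      expR (m * ((minn i.+1 j.+1)%:R / (maxn i.+1 j.+1)%:R)) - n%:R ^+ 2 * ((expR m - 1) / m)|
    <= n%:R * ((expR m - 1) / m + expR m).
Proof.
move=> m0; set L := (expR m - 1) / m.
pose a i j : R := expR (m * ((minn i.+1 j.+1)%:R / (maxn i.+1 j.+1)%:R)).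
have a_sym i j : a i j = a j i by rewrite /a minnC maxnC.
have L0 : 0 < L by rewrite divr_gt0 // subr_gt0 expR_gt1.
elim: n => [|n IHn]; first by rewrite big_ord0 expr0n !mul0r subrr normr0.
rewrite (sum_square_symS _ a n a_sym).
have -> : a n n = expR m.
  by rewrite /a minnn maxnn divff ?mulr1 // pnatr_eq0.
have -> : \sum_(k < n.+1) a k n =
          \sum_(k < n.+1) expR (m * (k.+1%:R / n.+1%:R)).
  apply: eq_bigr => k _.
  by rewrite /a (minn_idPl (ltn_ord k)) (maxn_idPr (ltn_ord k)).
have /andP[] := geometric_expR_sum_bounds R m n m0.
rewrite -/L; set T := \sum_(k < n.+1) expR _.
move: IHn; rewrite -natr1 mulr2n !ler_norml.
set S := \sum_(i < n) _; set N : R := n%:R.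
by move=> /andP[S1 S2] T1 T2; apply/andP; split; lra.
Qed.

Lemma entry_norm_minmaxX (R : realType) (m : R) (n : nat) : 1 <= m ->
  entry_norm m (exp_minmax_mx R n) `^ m =
  \sum_(i < n) \sum_(j < n)
    expR (m * ((minn i.+1 j.+1)%:R / (maxn i.+1 j.+1)%:R)).
Proof.
move=> m1; rewrite entry_normX //.
apply: eq_bigr => i _; apply: eq_bigr => j _.
by rewrite mxE gtr0_norm ?expR_gt0 // -expRM mulrC.
Qed.

Theorem mainTheorem1 (R : realType) (m : R) (hm : 1 <= m) :
  1 / n%:R ^+ 2 * entry_norm m (exp_minmax_mx R n) `^ m @[n --> \oo]
    --> 1 / m * (expR m - 1).
Proof.
have m0 : 0 < m by exact: lt_le_trans ltr01 hm.
rewrite mul1r mulrC; set L := (expR m - 1) / m.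
pose C := L + expR m.
(* The bound divided by [n^2] is [C / n], which is [C * harmonic] only after
   the index is shifted by one; the shift also excludes [n = 0]. *)
rewrite -cvg_shiftS.
apply: (@squeeze_cvgr _ _ _ _ (fun n => L - C * harmonic n)
                              (fun n => L + C * harmonic n)).
- near=> n; rewrite /=.
  rewrite entry_norm_minmaxX // -ler_distl.
  have := minmax_sum_bound R m n.+1 m0.
  rewrite -/L -/C; set S := \sum_(_ < _) _; set N : R := n.+1%:R => SN.
  have N0 : 0 < N by rewrite ltr0n.
  have -> : 1 / N ^+ 2 * S - L = (S - N ^+ 2 * L) / N ^+ 2.
    by field; rewrite gt_eqF.
  rewrite normrM normfV (gtr0_norm (exprn_gt0 2 N0)) ler_pdivrMr ?exprn_gt0 //.
  apply: le_trans SN _; rewrite /harmonic -/N le_eqVlt; apply/orP; left.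
  by apply/eqP; field; rewrite gt_eqF.
- rewrite -[X in _ --> X]subr0 -(mulr0 C).
  by apply: cvgB; [exact: cvg_cst | apply: cvgMl_tmp; exact: cvg_harmonic].
- rewrite -[X in _ --> X]addr0 -(mulr0 C).
  by apply: cvgD; [exact: cvg_cst | apply: cvgMl_tmp; exact: cvg_harmonic].
Unshelve. all: by end_near.
Qed.
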